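(* There exists a coherent topological space $X$ such that $\mathcal{Q}^*_v(X)$ is not coherent. In particular, in the implication ''if $X$ is coherent and weakly Hausdorff, then $\mathcal{Q}^*_v(X)$ is coherent and weakly Hausdorff'', the assumption that $X$ is weakly Hausdorff cannot be dropped.
   Context: A subset of a topological space $X$ is saturated if it is an intersection of open subsets of $X$. No separation is included in compactness. $X$ is coherent if the intersection of any two compact saturated subsets of $X$ is again compact saturated. $X$ is weakly Hausdorff if for all compact saturated subsets $Q_1,Q_2$ of $X$ and every open set $W\supseteq Q_1\cap Q_2$ there are open sets $U\supseteq Q_1$ and $V\supseteq Q_2$ with $U\cap V\subseteq W$. $\mathcal{Q}^*_v(X)$ denotes the set of all nonempty compact saturated subsets of $X$, equipped with the upper Vietoris topology, i.e. the topology generated by the basic open sets $\square U:=\{K: K\subseteq U\}$, $U$ ranging over the open subsets of $X$. *)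

(* Defs.v *)
From HB Require Import structures.
From mathcomp Require Import all_boot all_order.
From mathcomp Require Import all_classical.
From mathcomp Require Import topology_structure compact.

Set Implicit Arguments.
Unset Strict Implicit.
Unset Printing Implicit Defensive.

Local Open Scope classical_set_scope.

(* The empty family is allowed: its intersection is the whole space. *)
Definition saturated (X : topologicalType) (A : set X) : Prop :=
  exists2 F : set (set X), F `<=` open & A = \bigcap_(U in F) U.

Definition coherent (X : topologicalType) : Prop :=
  forall Q1 Q2 : set X, compact Q1 -> saturated Q1 ->
    compact Q2 -> saturated Q2 ->
    compact (Q1 `&` Q2) /\ saturated (Q1 `&` Q2).

Definition weakly_hausdorff (X : topologicalType) : Prop :=
  forall Q1 Q2 : set X, compact Q1 -> saturated Q1 ->
    compact Q2 -> saturated Q2 ->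
    forall W : set X, open W -> Q1 `&` Q2 `<=` W ->
    exists U V : set X,
      [/\ open U, open V, Q1 `<=` U, Q2 `<=` V & U `&` V `<=` W].

Record upper_vietoris (X : topologicalType) : Type := UpperVietoris {
  uv_set :> set X ;
  uv_nonempty : uv_set !=set0 ;
  uv_compact : compact uv_set ;
  uv_saturated : saturated uv_set
}.

HB.instance Definition _ (X : topologicalType) := gen_eqMixin (upper_vietoris X).
HB.instance Definition _ (X : topologicalType) :=
  gen_choiceMixin (upper_vietoris X).

Lemma uv_set_inj (X : topologicalType) : injective (@uv_set X).
Proof.
move=> [K K0 cK sK] [L L0 cL sL] /= KL; move: K0 cK sK; rewrite KL => K0 cK sK.
by congr UpperVietoris; exact: Prop_irrelevance.
Qed.

Definition box (X : topologicalType) (U : set X) : set (upper_vietoris X) :=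
  [set K : upper_vietoris X | K `<=` U].

Lemma box_cover (X : topologicalType) :
  \bigcup_(U in @open X) box U = setT.
Proof. by apply/seteqP; split=> // K _; exists setT => //; exact: openT. Qed.

Lemma box_join (X : topologicalType) (U V : set X) (K : upper_vietoris X) :
  open U -> open V -> box U K -> box V K ->
  exists W, [/\ open W, box W K & box W `<=` box U `&` box V].
Proof.
move=> oU oV KU KV; exists (U `&` V); split; first exact: openI.
  by move=> x Kx; split; [exact: KU|exact: KV].
by move=> L LUV; split=> x /LUV[].
Qed.

HB.instance Definition _ (X : topologicalType) :=
  isBaseTopological.Build (upper_vietoris X) (@box_cover X) (@box_join X).

Lemma open_upper_vietorisE (X : topologicalType) (O : set (upper_vietoris X)) :
  open O <-> exists2 B : set (set X), B `<=` open & \bigcup_(U in B) box U = O.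
Proof. by []. Qed.

(* Main.v *)
Require Import Defs.
From HB Require Import structures.
From mathcomp Require Import all_boot all_order.
From mathcomp Require Import all_classical.
From mathcomp Require Import topology_structure compact.

(** The counterexample is an array of points [Pt i n] (column [i], row [n])
    together with a point [Base] and two points [End c].  Columns carry the
    cofinite topology, so all their subsets are compact; a neighbourhood of
    [Base] contains almost all columns, so every set containing [Base] is
    compact; a neighbourhood of an [End c] contains [Base] and almost all
    finite rows [row n = {Pt i n | i < n}].

    Since [Base] lies in every neighbourhood of [End c], a saturated set
    meeting the ends contains [Base].  Hence the compact saturated sets are the
    saturated sets that contain [Base] or lie in finitely many columns
    ([compact_spaceP]), and this class is closed under intersection: the space
    is coherent.

    In the hyperspace, [row n] with [Base] and [End c] added converges to
    [{Base, End c}] as [n] grows, so for each [c] the compact saturated subsets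
    of these sets form a compact saturated family
    ([compact_below_sequence], [saturated_downward]).  In the intersection of
    the two families both ends are lost: it consists of the compact saturated
    subsets of the sets [{Base} `|` row n].  The limit [{Base}] does not force
    the rows to be nearby any more, because a neighbourhood of [Base] may omit
    a column, and all but finitely many rows meet that column.  Removing column
    [n] and the ends leaves an open set that contains [{Base} `|` row m]
    exactly when [m <= n], and these open sets give a cover without finite subcover. *)

Set Implicit Arguments.
Unset Strict Implicit.
Unset Printing Implicit Defensive.

Local Open Scope classical_set_scope.

(** * Compactness and saturation *)

Section Generalities.
Variable X : topologicalType.
Implicit Types (A : set X) (x y : X).

(** The form of compactness satisfied by a convergent sequence together with its
    limit [x]: a filter on [A] that does not cluster at [x] lives on one of the
    compact remainders [C]. *)
Lemma compact_near_point A x : A x ->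
  (forall U, open U -> U x ->
    exists C, [/\ compact C, C `<=` A & A `<=` U `|` C]) ->
  compact A.
Proof.
move=> Ax hA F PF FA.
have [Fx|nFx] := pselect (cluster F x); first by exists x.
have [E [V [FE Vx EV0]]] : exists E V, [/\ F E, nbhs x V & ~ (E `&` V !=set0)].
  apply: contrapT => h; apply: nFx => E V FE Vx.
  by apply: contrapT => EV0; apply: h; exists E, V.
move: Vx; rewrite nbhsE => -[U [oU Ux] UV].
have [C [cC CA AUC]] := hA _ oU Ux.
have FC : F C.
  apply: filterS (filterI FE FA) => z [Ez Az].
  by have [/UV Vz|//] := AUC z Az; case: EV0; exists z.
by have [z [Cz Fz]] := cC F PF FC; exists z; split=> //; exact: CA.
Qed.

Lemma compact_setI_bigcup A (L : nat -> set X) N :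
  (forall k, compact (A `&` L k)) -> compact (A `&` \bigcup_(k < N) L k).
Proof.
by move=> cL; rewrite setI_bigcupr bigcup_mkord; exact: bigsetU_compact.
Qed.

Lemma compact_setI_set1 A x : compact (A `&` [set x]).
Proof.
have [->|->] : A `&` [set x] = set0 \/ A `&` [set x] = [set x].
- by apply: subset_set1 => y [].
- exact: compact0.
- exact: compact_set1.
Qed.

Lemma compact_countable_cover A (U : nat -> set X) :
  compact A -> (forall n, open (U n)) -> A `<=` \bigcup_n U n ->
  exists N, A `<=` \bigcup_(n in [set k | k <= N]) U n.
Proof.
move=> cA oU AU; apply: contrapT => nN.
(* The remainders of [A] form a proper filter basis without cluster point in [A]. *)
pose E N := A `\` \bigcup_(n in [set k | k <= N]) U n.
have PF : ProperFilter (filter_from setT E).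
  apply: filter_from_proper => [|N _]; last first.
    apply: contrapT => EN0; apply: nN; exists N => x Ax.
    by apply: contrapT => nUx; apply: EN0; exists x.
  apply: filter_fromT_filter => [|N M]; first by exists 0.
  exists (maxn N M) => x [Ax nUx]; split; split=> // -[k kN Ux]; apply: nUx;
    by exists k => //=; rewrite leq_max kN ?orbT.
have FA : filter_from setT E A by exists 0 => // x [].
have [x [Ax Fx]] := cA _ PF FA.
have [n _ Ux] := AU x Ax.
have [|y [[_ nUy] Uy]] := Fx (E n) (U n) _ (open_nbhs_nbhs (conj (oU n) Ux)).
  by exists n.
by apply: nUy; exists n => /=.
Qed.

(** Saturated sets are the upper sets of the specialization preorder. *)
Lemma saturated_separated A :
  (forall x y, A x -> ~ A y -> exists U, [/\ open U, U x & ~ U y]) ->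
  saturated A.
Proof.
move=> sepA; exists [set U | open U /\ A `<=` U]; first by move=> U [].
apply/seteqP; split=> [x Ax U [_]|y Fy]; first exact.
apply: contrapT => nAy.
have : (\bigcup_(U in [set U | open U /\ ~ U y]) U) y; last by case=> U [].
apply: Fy; split; first by apply: bigcup_open => U [].
by move=> x Ax; have [U [oU Ux nUy]] := sepA x y Ax nAy; exists U.
Qed.

Lemma saturatedI A B : saturated A -> saturated B -> saturated (A `&` B).
Proof.
move=> [F oF ->] [G oG ->]; exists (F `|` G); last by rewrite bigcap_setU.
by move=> U [/oF|/oG].
Qed.

Lemma saturated_specialization A x y :
  (forall U, open U -> U x -> U y) -> saturated A -> A x -> A y.
Proof. by move=> xy [F oF ->] Fx U FU; apply: xy (Fx U FU); exact: oF. Qed.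

End Generalities.

(** * Families of compact saturated sets *)

Section Hyperspace.
Variable X : topologicalType.
Implicit Types (K L : upper_vietoris X) (U : set X).

Lemma open_box U : open U -> open (box U).
Proof.
move=> oU; apply/open_upper_vietorisE; exists [set U]; first by move=> _ ->.
by rewrite bigcup_set1.
Qed.

Lemma open_box_nbhs (O : set (upper_vietoris X)) K : open O -> O K ->
  exists U, [/\ open U, K `<=` U & box U `<=` O].
Proof.
case/open_upper_vietorisE => B oB <- [U BU KU].
by exists U; split=> //; [exact: oB|exact: bigcup_sup].
Qed.

(** The specialization preorder of the hyperspace is reverse inclusion: if [L] is
    not a subset of [K], then some open set contains [K] but not [L], because [K]
    is saturated. *)
Lemma saturated_downward (A : set (upper_vietoris X)) :
  (forall K L, A K -> L `<=` K -> A L) -> saturated A.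
Proof.
move=> dA; apply: saturated_separated => M L AM nAL.
have [F oF MF] := uv_saturated M.
have [U [FU nLU]] : exists U, F U /\ ~ L `<=` U.
  apply: contrapT => h; apply: nAL; apply: (dA M) => //.
  rewrite MF => x Lx U FU; apply: contrapT => nUx.
  by apply: h; exists U; split=> // /(_ x Lx).
exists (box U); split=> //; first by apply: open_box; exact: oF.
by rewrite /box /= MF; exact: bigcap_inf.
Qed.

(** Every neighbourhood of [K] contains all the subsets of [K]. *)
Lemma compact_below K : compact [set L : upper_vietoris X | L `<=` K].
Proof.
apply: (@compact_near_point _ _ K) => // O oO OK; exists set0.
split=> //; first exact: compact0.
have [U [_ KU UO]] := open_box_nbhs oO OK.
by move=> L LK; left; apply: UO; exact: subset_trans KU.
Qed.

(** The family contains the limit, every neighbourhood of which contains almost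
    all the [K n] with their subsets; the finitely many remaining terms are
    handled by [compact_below]. *)
Lemma compact_below_sequence (K : nat -> upper_vietoris X) (Kinf : upper_vietoris X) :
  Kinf `<=` K 0 ->
  (forall U, open U -> Kinf `<=` U -> \forall n \near \oo, K n `<=` U) ->
  compact [set L : upper_vietoris X | exists n, L `<=` K n].
Proof.
move=> K0 Kcvg; apply: (@compact_near_point _ _ Kinf); first by exists 0.
move=> O oO OK; have [U [oU KU UO]] := open_box_nbhs oO OK.
have [N _ KN] := Kcvg _ oU KU.
exists (setT `&` \bigcup_(n < N) [set L : upper_vietoris X | L `<=` K n]).
split.
- by apply: compact_setI_bigcup => n; rewrite setTI; exact: compact_below.
- by move=> L [_ [n _ LK]]; exists n.
- move=> L [n LK]; have [Nn|nN] := leqP N n.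
    by left; apply: UO; apply: subset_trans LK _; exact: KN.
  by right; split=> //; exists n.
Qed.

End Hyperspace.

(** * The space *)

Inductive space := Pt of nat & nat | Base | End of bool.

HB.instance Definition _ := gen_eqMixin space.
HB.instance Definition _ := gen_choiceMixin space.

Definition row n : set space := [set x | exists2 i, i < n & x = Pt i n].

Definition space_open (U : set space) : Prop :=
  [/\ forall i n, U (Pt i n) -> \forall m \near \oo, U (Pt i m),
      U Base -> \forall i \near \oo, forall n, U (Pt i n) &
      forall c, U (End c) -> U Base /\ \forall n \near \oo, row n `<=` U].

Lemma space_openT : space_open setT.
Proof. by split=> *; do ?split=> //; exists 0. Qed.

Lemma space_openI : setI_closed space_open.
Proof.
move=> U V [Uc Ub Ue] [Vc Vb Ve]; split.
- by move=> i n [/Uc Ui /Vc Vi]; exact: filterI.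
- by case=> /Ub h /Vb; apply: filterS2 h => i Ui Vi n.
- move=> c [/Ue [U0 h] /Ve [V0]] k; split=> //.
  by apply: filterS2 h k => n Un Vn x rx; split; [exact: Un|exact: Vn].
Qed.

Lemma space_open_bigU (I : Type) (f : I -> set space) :
  (forall i, space_open (f i)) -> space_open (\bigcup_i f i).
Proof.
move=> of_; split.
- move=> i n [k _ fk]; have [h _ _] := of_ k.
  by apply: filterS (h _ _ fk) => m fm; exists k.
- move=> [k _ fk]; have [_ h _] := of_ k.
  by apply: filterS (h fk) => i fi n; exists k.
- move=> c [k _ fk]; have [_ _ h] := of_ k; have [f0 fr] := h _ fk.
  by split; [exists k|apply: filterS fr => n fn x /fn; exists k].
Qed.

HB.instance Definition _ :=
  isOpenTopological.Build space space_openT space_openI space_open_bigU.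

Lemma open_spaceE (U : set space) : open U = space_open U.
Proof. by []. Qed.

Definition column i : set space := range (Pt i).

Lemma open_column i : open (column i).
Proof.
rewrite open_spaceE; split; last 2 first.
- by case.
- by move=> c [].
by move=> _ _ [m _ [<- _]]; exists 0 => // k _; exists k.
Qed.

Definition omit_column n : set space :=
  [set x | x = Base \/ exists2 i, i != n & column i x].

Lemma open_omit_column n : open (omit_column n).
Proof.
rewrite open_spaceE; split.
- move=> i m [//|[j jn [k _ [<- _]]]].
  by exists 0 => // l _; right; exists j => //; exists l.
- move=> _; exists n.+1 => // i ni m; right; exists i; last by exists m.
  by rewrite gtn_eqF.
- by move=> c [//|[i _ [? _]]].
Qed.

Lemma open_setC1 x : x != Base -> open (~` [set x]).
Proof.
move=> /eqP xB; rewrite open_spaceE; case: x xB => [j k|//|d] _.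
- split=> [i n _|_|c _].
  + by exists k.+1 => // m km [_ mk]; move: km; rewrite mk /= ltnn.
  + by exists j.+1 => // i ji n [ij _]; move: ji; rewrite ij /= ltnn.
  + split=> //; exists k.+1 => // n kn _ [i _ ->] [_ nk].
    by move: kn; rewrite nk /= ltnn.
- split=> [i n _|_|c _]; first by exists 0.
  + by exists 0.
  + by split=> //; exists 0 => // n _ _ [i _ ->].
Qed.

(** [Base] is a point of every neighbourhood of an end, and apart from this the
    space satisfies the T1 axiom. *)
Lemma saturated_spaceP (A : set space) :
  saturated A <-> forall c, A (End c) -> A Base.
Proof.
split=> [sA c|AB].
  apply: saturated_specialization sA => U; rewrite open_spaceE.
  by move=> [_ _ Ue] /Ue [].
apply: saturated_separated => x y Ax nAy.
have [yB|yB] := eqVneq y Base; last first.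
  exists (~` [set y]); split=> [||]; first exact: open_setC1.
    by move=> xy; apply: nAy; rewrite -xy.
  by apply.
rewrite {}yB {y} in nAy *.
case: x Ax => [i n _|//|c /AB //].
by exists (column i); split; [exact: open_column|exists n|case].
Qed.

(** * Its compact saturated sets *)

(** A neighbourhood of any point of a column omits only finitely many points of
    that column. *)
Lemma compact_in_column (A : set space) i : compact (A `&` column i).
Proof.
have [->|/set0P[x [Ax cx]]] := eqVneq (A `&` column i) set0.
  exact: compact0.
apply: (@compact_near_point _ _ x) => // U; rewrite open_spaceE => -[Uc _ _] Ux.
case: cx Ux => n _ <- /Uc [N _ UN].
exists ((A `&` column i) `&` \bigcup_(m < N) [set Pt i m]); split.
- by apply: compact_setI_bigcup => m; exact: compact_setI_set1.
- by move=> y [].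
- move=> y [Ay [m _ ym]]; have [Nm|mN] := leqP N m.
    by left; rewrite -ym; exact: UN.
  by right; split; [split=> //; exists m|exists m].
Qed.

Lemma compact_in_columns (A : set space) N :
  A `<=` \bigcup_(i < N) column i -> compact A.
Proof.
move=> /setIidl <-; apply: compact_setI_bigcup => i; exact: compact_in_column.
Qed.

(** A neighbourhood of [Base] leaves out part of finitely many columns and
    possibly the two ends, and this remainder is compact. *)
Lemma compact_Base (A : set space) : A Base -> compact A.
Proof.
move=> AB; apply: (@compact_near_point _ _ Base) => // U.
rewrite open_spaceE => -[_ Ub _] /[dup] UB /Ub [N _ UN].
exists ((A `&` \bigcup_(i < N) column i) `|`
  (A `&` [set End true] `|` A `&` [set End false])); split.
- apply: compactU; last by apply: compactU; exact: compact_setI_set1.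
  by apply: compact_setI_bigcup => i; exact: compact_in_column.
- by move=> x [[]|[[]|[]]].
- move=> [i n|//|[]] Ax; [|by left|by right; right; left|by right; right; right].
  have [Ni|iN] := leqP N i; first by left; exact: UN.
  by right; left; split=> //; exists i => //; exists n.
Qed.

(** The columns are open and cover every saturated set without [Base], so such a
    set is compact only if finitely many columns suffice. *)
Lemma compact_spaceP (A : set space) : saturated A ->
  compact A <-> A Base \/ exists N, A `<=` \bigcup_(i < N) column i.
Proof.
move=> /saturated_spaceP sA; split=> [cA|[|[N]]]; last 2 first.
- exact: compact_Base.
- exact: compact_in_columns.
have [AB|nAB] := pselect (A Base); [by left|right].
have [|N AN] := compact_countable_cover cA open_column.
  by move=> [i n|//|c /sA //] _; exists i => //; exists n.
by exists N.+1.
Qed.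

Lemma coherent_space : coherent space.
Proof.
move=> A B cA sA cB sB; split; last exact: saturatedI.
apply/compact_spaceP; first exact: saturatedI.
move/(compact_spaceP sA): cA => [AB|[N AN]]; last first.
  by right; exists N => x [/AN].
move/(compact_spaceP sB): cB => [BB|[N BN]]; first by left.
by right; exists N => x [_ /BN].
Qed.

(** * Its hyperspace is not coherent *)

Section CompactWithBase.
Variables (A : set space) (AB : A Base).

Definition with_Base : upper_vietoris space.
Proof.
apply: (@UpperVietoris _ A); first by exists Base.
- exact: compact_Base.
- by apply/saturated_spaceP.
Defined.

End CompactWithBase.

Definition row_end c n : set space := row n `|` [set Base; End c].

Lemma row_end_Base c n : row_end c n Base.
Proof. by right; left. Qed.

Definition row_point c n := with_Base (row_end_Base c n).

Definition row_family c : set (upper_vietoris space) :=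
  [set L | exists n, L `<=` row_end c n].

Lemma compact_row_family c : compact (row_family c).
Proof.
apply: (@compact_below_sequence _ (row_point c) (row_point c 0)) => //= U.
rewrite open_spaceE => -[_ _ Ue] U0.
have /Ue [UB] : U (End c) by apply: U0; right; right.
apply: filterS => n nU x [/nU //|[-> //|->]].
by apply: U0; right; right.
Qed.

Lemma saturated_row_family c : saturated (row_family c).
Proof.
apply: saturated_downward => K L [n Kn] LK.
by exists n; exact: subset_trans Kn.
Qed.

(** Sets of the first family avoid [End false], those of the second avoid
    [End true]. *)
Lemma row_familyI (L : upper_vietoris space) :
  row_family true L -> row_family false L -> exists n, L `<=` row n `|` [set Base].
Proof.
move=> [n Ln] [m Lm]; exists n => x Lx.
have [|[]] := Ln x Lx; [by left|by right|].
by move=> /= xt; have := Lm x Lx; rewrite xt => -[[]|[]].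
Qed.

(** [omit_column n] contains [row m] exactly when [m <= n], so finitely many of
    these open sets miss all long rows. *)
Lemma ncompact_row_familyI : ~ compact (row_family true `&` row_family false).
Proof.
move=> /compact_countable_cover cover_row_familyI.
have [||N NU] := cover_row_familyI (fun n => box (omit_column n)).
- by move=> n; exact: open_box (open_omit_column n).
- move=> L [Lt Lf].
  have [n Ln] := row_familyI Lt Lf; exists n => // x /Ln [[i ni ->]|->].
    by right; exists i; [rewrite ltn_eqF|exists n].
  by left.
have RB : (row N.+1 `|` [set Base]) Base by right.
(* Row [N.+1] meets each of the columns [0], ..., [N] that are removed. *)
have [|n /= nN /(_ (Pt n N.+1))] := NU (with_Base RB).
  by split; exists N.+1 => x [|->]; [left|right; left|left|right; left].
case=> //; first by left; exists n.
by move=> [i /eqP inn [k _ [/inn]]].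
Qed.

Lemma ncoherent_upper_vietoris_space : ~ coherent (upper_vietoris space).
Proof.
move=> coh; apply: ncompact_row_familyI.
by have [] := coh _ _ (@compact_row_family true) (@saturated_row_family true)
  (@compact_row_family false) (@saturated_row_family false).
Qed.

Theorem theorem4p8 :
  (exists X : topologicalType, coherent X /\ ~ coherent (upper_vietoris X)) /\
  ~ (forall X : topologicalType, coherent X ->
       coherent (upper_vietoris X) /\ weakly_hausdorff (upper_vietoris X)).
Proof.
split.
  exists space; split; first exact: coherent_space.
  exact: ncoherent_upper_vietoris_space.
move=> /(_ space coherent_space) [coh _].
exact: ncoherent_upper_vietoris_space coh.
Qed.
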